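(* There exist a subset $U\subseteq\mathbb{R}$ and a collection $\mathcal{B}$ of subsets of $\mathbb{R}$ such that $\mathcal{B}$ is a basis for a topology $\mathcal{T}$ on $\mathbb{R}$ and also a basis for a countable union topology $\mathcal{T}_C$ on $\mathbb{R}$, and such that, writing $\mathbb{M}=(\mathbb{R},\mathcal{T})$ and $\mathbb{M}_C=(\mathbb{R},\mathcal{T}_C)$ and giving the codomain $\mathbb{R}$ its usual topology, the indicator function $$f(x)=\begin{cases}0 & \text{if } x\notin U,\\ 1 & \text{if } x\in U\end{cases}$$ is continuous as a function $f:\mathbb{M}\to\mathbb{R}$, but is not continuous as a function $f:\mathbb{M}_C\to\mathbb{R}$.
   Context: A countable union topology on a set $X$ is a collection $\mathcal{T}_C$ of subsets of $X$ (called its open sets) such that: (1) $\emptyset$ and $X$ belong to $\mathcal{T}_C$; (2) the union of countably many elements of $\mathcal{T}_C$ belongs to $\mathcal{T}_C$; (3) the intersection of any finite collection of elements of $\mathcal{T}_C$ belongs to $\mathcal{T}_C$. This is the usual definition of a topology with the requirement on arbitrary unions weakened to countable unions. A collection $\mathcal{B}$ of subsets of $X$ is a basis for a topology $\mathcal{T}$ on $X$ if $\mathcal{T}$ is a topology and equals the collection of all possible unions of elements of $\mathcal{B}$. A collection $\mathcal{B}$ of subsets of $X$ is a basis for a countable union topology $\mathcal{T}_C$ on $X$ if $\mathcal{T}_C$ is a countable union topology and equals the collection of all possible countable unions of elements of $\mathcal{B}\cup\{X\}$. In both cases the empty union $\emptyset$ is allowed. If $X$ carries a topology or a countable union topology and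 $Y$ carries a topology, a function $f:X\to Y$ is continuous if for each open subset $V$ of $Y$ the set $f^{-1}(V)$ is an open subset of $X$ (that is, an element of the given topology or countable union topology on $X$). *)

(* Defs.v *)
From mathcomp Require Import all_boot all_order all_algebra.
From mathcomp Require Import all_classical all_reals all_analysis.

Set Implicit Arguments.
Unset Strict Implicit.
Unset Printing Implicit Defensive.

Local Open Scope classical_set_scope.

(* Topologies are plain collections of subsets rather than instances of
   [topologicalType], so that several of them can coexist on one carrier. *)
Definition is_topology (X : Type) (O : set (set X)) : Prop :=
  [/\ O set0, O setT,
      forall F : set (set X), F `<=` O -> O (\bigcup_(A in F) A) &
      forall F : set (set X), F `<=` O -> finite_set F -> O (\bigcap_(A in F) A)].

Definition is_countable_union_topology (X : Type) (O : set (set X)) : Prop :=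
  [/\ O set0, O setT,
      forall F : set (set X), F `<=` O -> countable F -> O (\bigcup_(A in F) A) &
      forall F : set (set X), F `<=` O -> finite_set F -> O (\bigcap_(A in F) A)].

(* Here and below the family [F] may be empty, which gives [set0]. *)
Definition is_topology_basis (X : Type) (B O : set (set X)) : Prop :=
  is_topology O /\
  O = [set A | exists2 F : set (set X), F `<=` B & A = \bigcup_(V in F) V].

(* [countable] includes finite, so finite unions are covered. *)
Definition is_countable_union_basis (X : Type) (B O : set (set X)) : Prop :=
  is_countable_union_topology O /\
  O = [set A | exists F : set (set X),
         [/\ F `<=` B `|` [set setT], countable F & A = \bigcup_(V in F) V]].

Definition continuous_from (X : Type) (Y : topologicalType)
    (O : set (set X)) (f : X -> Y) : Prop :=
  forall V : set Y, open V -> O (f @^-1` V).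

(* Main.v *)
(* Take for [B] the singletons. Then [T] is the discrete topology, for which
   every function is continuous, whereas [TC] consists of [setT] and the
   countable sets. With [U] the unit interval, the preimage of ]0, +oo[ under
   the indicator function is [U], which is uncountable and proper. *)
Require Import Defs.
From mathcomp Require Import all_boot all_order all_algebra.
From mathcomp Require Import all_classical all_reals all_analysis.
Import Order.TTheory GRing.Theory Num.Theory.
Import numFieldNormedType.Exports.
Local Open Scope classical_set_scope.
Local Open Scope ring_scope.

Lemma is_topology_basis_set1 (X : Type) :
  is_topology_basis (range (@set1 X)) setT.
Proof.
split; first by split.
apply/esym; rewrite -subTset => A _ /=.
exists (set1 @` A); first exact: image_subset.
by rewrite bigcup_image bigcup_imset1 image_id.
Qed.

(** A countable union of members is countable unless some member is [setT], and then it is [setT].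
    An intersection is [setT] when all members are, and otherwise lies inside a countable member. *)
Lemma is_countable_union_topology_countable (X : Type) :
  is_countable_union_topology [set A : set X | A = setT \/ countable A].
Proof.
split => [||F FO cF|F FO _] /=.
- by right; exact: countable0.
- by left.
- have [FT|FT] := pselect (F setT).
    by left; rewrite -subTset => x _; exists setT.
  right; apply: bigcup_countable => // A FA.
  by case: (FO _ FA) => // AT; rewrite AT in FA.
- have [FT|] := pselect (F `<=` [set setT]).
    by left; rewrite -subTset => x _ A /FT ->.
  move=> /existsNP[A /not_implyP[FA AT]].
  case: (FO _ FA) => // cA; right.
  by apply: sub_countable cA; apply: subset_card_le => x; apply.
Qed.

Lemma is_countable_union_basis_set1 (X : Type) :
  is_countable_union_basis (range (@set1 X))
    [set A | A = setT \/ countable A].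
Proof.
have tX := is_countable_union_topology_countable X.
split=> //; apply/seteqP; split=> A /=.
- case=> [->|cA].
    (* As [X] may be uncountable, [setT] comes from the extra generator [setT] and not from
       singletons. *)
    exists [set setT]; split; last by rewrite bigcup_set1.
    + exact: subsetUr.
    + exact: countable1.
  exists (set1 @` A); split.
  + by move=> _ [x _ <-]; left; exists x.
  + by apply: sub_countable cA; exact: card_image_le.
  + by rewrite bigcup_image bigcup_imset1 image_id.
- move=> [F [FB cF ->]].
  (* Each generator, a singleton or [setT], is itself open, so closure under countable unions
     concludes. *)
  case: tX => _ _ bigcupX _; apply: bigcupX => // {}A /FB[[x _ <-]|->].
  + by right; exact: countable1.
  + by left.
Qed.

(** A countable set has Lebesgue measure zero, whereas this interval has measure 1. *)
Lemma uncountable_itvcc01 (R : realType) : ~ countable (`[0, 1] : set R).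
Proof.
move=> /countable_lebesgue_measure0/eqP.
by rewrite lebesgue_measure_itv/= lte_fin ltr01 oppr0 adde0 eqe oner_eq0.
Qed.

Theorem theorem1p1 (R : realType) :
  exists (U : set R) (B T TC : set (set R)),
    [/\ is_topology_basis B T,
        is_countable_union_basis B TC,
        continuous_from T (\1_U : R -> R) &
        ~ continuous_from TC (\1_U : R -> R)].
Proof.
exists [set` `[0, 1]], (range set1), setT, [set A | A = setT \/ countable A].
split=> //.
- exact: is_topology_basis_set1.
- exact: is_countable_union_basis_set1.
- move=> /(_ _ (rray_open (0 : R))).
  have -> : (\1_[set` `[0, 1]] : R -> R) @^-1` [set` `]0, +oo[] = [set` `[0, 1]].
    apply/seteqP; split=> x; rewrite /= indicE.
      by case: (boolP (x \in _)) => [/set_mem//|_]; rewrite in_itv/= ltxx.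
    by move=> x01; rewrite mem_set//= in_itv/= ltr01.
  case=> [|/uncountable_itvcc01//].
  (* The point 2 witnesses that the unit interval is not [setT]. *)
  by move/seteqP => [_ /(_ 2 I)] /=; rewrite in_itv/= ler0n (ler_nat _ 2 1).
Qed.
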